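(* Let $R$ be a commutative ring with ${\rm Nil}(R)=0$ (for example, this holds when $J(R)=0$), and let $n\ge 1$ be an integer. The following are equivalent: (1) Every matrix in $\mathbb{M}_n(R)$ is a sum of three idempotents of $\mathbb{M}_n(R)$. (2) $R\cong A\times B$, where $A$ is a Boolean ring and $B$ is zero or a subdirect product of $\mathbb{Z}_3$'s. (3) $R$ satisfies the identity $x^3=x$.
   Context: Rings are associative with $1$. ${\rm Nil}(R)$ is the set of nilpotent elements of $R$ and $J(R)$ is the Jacobson radical of $R$. $\mathbb{M}_n(R)$ is the ring of $n\times n$ matrices over $R$. An element $a$ of a ring is an idempotent if $a^2=a$. A ring is Boolean if each of its elements is an idempotent (the zero ring is allowed as a Boolean ring). $\mathbb{Z}_3$ is the ring of integers modulo $3$; a ring is a subdirect product of $\mathbb{Z}_3$'s if it is isomorphic to a (unital) subring of a direct product of copies of $\mathbb{Z}_3$ (over an arbitrary index set) projecting onto each factor. $R$ satisfies the identity $x^3=x$ if $x^3=x$ for every $x\in R$. *)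

(* Defs.v *)
From mathcomp Require Import all_boot all_order all_algebra.
From mathcomp Require Import boolp classical_sets functions.

Set Implicit Arguments.
Unset Strict Implicit.
Unset Printing Implicit Defensive.

Import GRing.Theory.
Local Open Scope ring_scope.

(* Rings are [pzRingType]s: unlike [nzRingType], this includes the zero ring. *)

Definition nilpotent_elt (S : pzRingType) (a : S) : Prop :=
  exists m : nat, a ^+ m = 0.

Definition idempotent_elt (S : pzRingType) (a : S) : Prop := a ^+ 2 = a.

Definition sum_of_three_idempotents (S : pzRingType) (a : S) : Prop :=
  exists e f g : S,
    [/\ idempotent_elt e, idempotent_elt f, idempotent_elt g
      & a = e + f + g].

Definition boolean_ring (S : pzRingType) : Prop :=
  forall a : S, idempotent_elt a.

Definition zero_ring (S : pzRingType) : Prop := forall a : S, a = 0.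

(* The direct product is the ring [I -> 'Z_3] with pointwise operations; the
   image of the injective morphism [phi] is the subring isomorphic to [S]. *)
Definition subdirect_product_of_Z3 (S : pzRingType) : Prop :=
  exists (I : Type) (phi : {rmorphism S -> (I -> 'Z_3)}),
    injective phi /\ forall (i : I) (z : 'Z_3), exists s : S, phi s i = z.

Definition ring_isomorphic (S T : pzRingType) : Prop :=
  exists phi : {rmorphism S -> T}, bijective phi.

Definition identity_cube (S : pzRingType) : Prop := forall x : S, x ^+ 3 = x.

(* Main.v *)
Require Import Defs.
From HB Require Import structures.
From mathcomp Require Import all_boot all_order all_algebra.
From mathcomp Require Import ring zify.
From mathcomp Require Import boolp classical_sets functions.

(* (1) => (3). The trace of an idempotent n x n matrix over a commutative ring is
   a root of X (X - 1) ... (X - n), so under (1) every x in R satisfies c x = k c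
   for some natural number k and some nonzero multiple c of any prescribed
   nonzero element. If x^3 <> x, choose c among the multiples of x^3 - x with
   moreover p c = 0 for a prime p: as R is reduced, k^3 - k is prime to p, so
   p >= 5. Since all entries can be made integral in this way, (1) descends to
   matrices over F_p, where it fails: for p >= 5 the matrix -1, or
   diag(1, -1, ..., -1) if p = 5 and n is even, is not a sum of three
   idempotents.

   (3) => (2). As 6 = 0 and 3, 4 are complementary idempotents, R = 3R x 4R with
   3R Boolean, and maximal ideals give enough morphisms from 4R to Z_3.

   (3) => (1). Finitely many idempotents cut R into pieces over which a given
   matrix has entries in F_2 or F_3. Over these fields a matrix is a direct sum
   of matrices of cyclic endomorphisms, and those are sums of three idempotents
   by an explicit decomposition of a Hessenberg form. *)

Set Implicit Arguments.
Unset Strict Implicit.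
Unset Printing Implicit Defensive.

Import GRing.Theory.
Local Open Scope ring_scope.

(** * Matrices that are not sums of three idempotents *)

Lemma mx_idempotentE (R : pzRingType) n (e : 'M[R]_n) :
  idempotent_elt e <-> e *m e = e.
Proof. by rewrite /idempotent_elt expr2 -mulmxE. Qed.

(** Write [e = P Q] with [P], [Q] of full rank: cancelling in [e e = e] leaves [Q P = 1], an
    identity matrix of size [\rank e] with the trace of [e]. *)
Lemma mxtrace_idempotent (F : fieldType) n (e : 'M[F]_n) :
  e *m e = e -> \tr e = (\rank e)%:R.
Proof.
move=> ee; rewrite -{1}(mulmx_base e) mxtrace_mulC.
suff -> : row_base e *m col_base e = 1%:M by rewrite mxtrace1.
move: (mulmx_base e) (col_base_full e) (row_base_free e).
move: (col_base e) (row_base e) => P Q PQ fP fQ.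
apply: (row_full_inj fP); apply: (row_free_inj fQ).
by rewrite mulmx1 !mulmxA PQ -mulmxA PQ.
Qed.

Lemma mx_addE (R : pzRingType) m n (A B : 'M[R]_(m, n)) i j :
  (A + B) i j = A i j + B i j.
Proof. by rewrite mxE. Qed.

Lemma mx_oppE (R : pzRingType) m n (A : 'M[R]_(m, n)) i j :
  (- A) i j = - A i j.
Proof. by rewrite mxE. Qed.

Lemma mx_scaleE (R : pzRingType) m n (a : R) (A : 'M[R]_(m, n)) i j :
  (a *: A) i j = a * A i j.
Proof. by rewrite mxE. Qed.

Lemma mx_natmulE (R : pzRingType) m n (A : 'M[R]_(m, n)) k i j :
  (A *+ k) i j = A i j *+ k.
Proof. by rewrite mulmxnE. Qed.

Lemma mx_scalarE (R : pzRingType) n (a : R) i j :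
  (a%:M : 'M[R]_n) i j = a * (i == j)%:R.
Proof. by rewrite mxE mulr_natr. Qed.

Lemma mx_zeroE (R : pzRingType) m n i j : (0 : 'M[R]_(m, n)) i j = 0.
Proof. by rewrite mxE. Qed.

(* Linear identities between matrices, checked entrywise with products of
   matrices left as atoms. *)
Ltac mxlin :=
  apply/matrixP => ? ?;
  rewrite !(mx_addE, mx_oppE, mx_scaleE, mx_natmulE, mx_scalarE, mx_zeroE);
  ring.

(* For K = f + g - 1 the difference D = f - g anticommutes with K and satisfies
   D^2 = 1 - K^2, so D embeds the eigenspace of m into the eigenspace of -m
   when m^2 <> 1. *)
Lemma eigenspace_sum_idempotents_le (F : fieldType) n (f g : 'M[F]_n) (m : F) :
  f *m f = f -> g *m g = g -> m ^+ 2 != 1 ->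
  (\rank (eigenspace (f + g - 1%:M) m) <=
   \rank (eigenspace (f + g - 1%:M) (- m)))%N.
Proof.
move=> ff gg m2; set K := _ - _; set V := eigenspace K m.
have VK : V *m K = m *: V by apply/eigenspaceP.
pose D := f - g.
have DK : D *m K = - (K *m D).
  rewrite /D /K !(mulmxBl, mulmxBr, mulmxDl, mulmxDr, mul1mx, mulmx1) ff gg.
  mxlin.
have DD : D *m D = 1%:M - K *m K.
  rewrite /D /K !(mulmxBl, mulmxBr, mulmxDl, mulmxDr, mul1mx, mulmx1) ff gg.
  mxlin.
have sVD : (V *m D <= eigenspace K (- m))%MS.
  by apply/eigenspaceP; rewrite -mulmxA DK mulmxN mulmxA VK -scalemxAl scaleNr.
apply: leq_trans (mxrankS sVD).
have VDD : V *m D *m D = (1 - m ^+ 2) *: V.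
  rewrite -mulmxA DD mulmxBr mulmx1 mulmxA VK -scalemxAl VK scalerA scalerBl.
  by rewrite scale1r expr2.
have m2' : 1 - m ^+ 2 != 0 by rewrite subr_eq0 eq_sym.
by rewrite -(eqmx_scale V m2') -VDD mxrankM_maxl.
Qed.

Lemma eigenspace_sum_idempotents (F : fieldType) n (f g : 'M[F]_n) (m : F) :
  f *m f = f -> g *m g = g -> m ^+ 2 != 1 ->
  \rank (eigenspace (f + g - 1%:M) m) =
  \rank (eigenspace (f + g - 1%:M) (- m)).
Proof.
move=> ff gg m2; apply/eqP; rewrite eqn_leq eigenspace_sum_idempotents_le //=.
by rewrite -{2}[m]opprK eigenspace_sum_idempotents_le // sqrrN.
Qed.

(** Here f + g - 1 = N - 2 - e, and its eigenspaces for 2 and -2 have equal dimension because 2^2 -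
    1 = 3 is nonzero. *)
Lemma rank_three_idempotents (F : fieldType) n (e f g N : 'M[F]_n) :
  e *m e = e -> f *m f = f -> g *m g = g -> 3 != 0 :> F ->
  N - 1%:M = e + f + g -> \rank (N - e) = \rank (N - e - 4%:M).
Proof.
move=> ee ff gg n3 eN.
have m2 : (2 : F) ^+ 2 != 1.
  by rewrite -subr_eq0; have -> : (2 : F) ^+ 2 - 1 = 3 by ring.
have := eigenspace_sum_idempotents ff gg m2.
have fg : f + g = N - 1%:M - e by rewrite eN; mxlin.
rewrite /eigenspace !mxrank_ker fg.
have -> : N - 1%:M - e - 1%:M - (- 2)%:M = N - e.
  mxlin.
have -> : N - 1%:M - e - 1%:M - 2%:M = N - e - 4%:M.
  mxlin.
have := rank_leq_row (N - e); have := rank_leq_row (N - e - 4%:M); lia.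
Qed.

Lemma rank_idempotent_compl (F : fieldType) n (e : 'M[F]_n) :
  e *m e = e -> (\rank (1%:M - e)%R + \rank e = n)%N.
Proof.
move=> ee; have -> : \rank (1%:M - e) = \rank (kermx e).
  apply/eqP; rewrite eqn_leq; apply/andP; split; apply: mxrankS.
    by apply/sub_kermxP; rewrite mulmxBl mul1mx ee subrr.
  have {1}-> : kermx e = kermx e *m (1%:M - e).
    by rewrite mulmxBr mulmx1 mulmx_ker subr0.
  exact: submxMl.
by rewrite mxrank_ker subnK // rank_leq_row.
Qed.

(** The counterexample is [N - 1] with [N = 0] in odd size and [N = diag(2, 0, ..., 0)] in even
    size. Rank bounds force each idempotent to have half the size as rank, absurd in odd size; in
    even size 2q, traces give 2 = 5q = 0. *)
Lemma no_three_idempotents_char5 (F : fieldType) n :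
  (0 < n)%N -> 2 != 0 :> F -> 5 = 0 :> F ->
  exists M : 'M[F]_n, ~ sum_of_three_idempotents M.
Proof.
case: n => // n _ n2 n5.
have n3 : 3 != 0 :> F.
  by apply: contra_neq n2 => n3; rewrite -[2]/(1 + 1) -[RHS]n5 -[LHS]addr0 -[X in _ + X]n3; ring.
(* The size is now n + 1, so [odd n] means even size. *)
pose a : F := (odd n)%:R * 2.
have aa : a * a = 2 * a by rewrite /a; case: (odd n) => /=; ring.
pose N : 'M[F]_n.+1 := a *: delta_mx 0 0.
have NN : N *m N = 2 *: N.
  by rewrite /N -scalemxAl -scalemxAr mul_delta_mx !scalerA aa.
have rN : (\rank N <= odd n)%N.
  rewrite /N /a; case: (odd n); last by rewrite mul0r scale0r mxrank0.
  by rewrite (leq_trans (mxrankS (scalemx_sub _ (submx_refl _)))) ?mxrank_delta.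
have tN : \tr N = a.
  by rewrite /N mxtraceZ /mxtrace (bigD1 0) //= big1 ?addr0 ?mxE ?mulr1 // => i ni; rewrite mxE (negPf ni).
have U1 : (1%:M - N) *m (1%:M - N) = 1%:M.
  rewrite !(mulmxBl, mulmxBr, mul1mx, mulmx1) NN; mxlin.
have U2 : (1%:M + N) *m (1%:M + 3 *: N) = 1%:M.
  rewrite !(mulmxDl, mulmxDr, mul1mx, mulmx1) -scalemxAr NN.
  transitivity (1%:M + 5 *: (2 *: N)); first by mxlin.
  by rewrite n5 scale0r addr0.
exists (N - 1%:M) => -[e [f [g [/mx_idempotentE ee /mx_idempotentE ff /mx_idempotentE gg eN]]]].
(* As -4 = 1, [N - h] and [N + (1 - h)] have equal rank. It exceeds neither the rank of [h] nor that
   of [1 - h] by more than [\rank N], and is at least both; so these two ranks differ by at most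
   [odd n], and parity concludes as their sum is n + 1. *)
have key h h1 h2 : h *m h = h -> h1 *m h1 = h1 -> h2 *m h2 = h2 -> N - 1%:M = h + h1 + h2 -> odd n /\ (\rank h + \rank h = n.+1)%N.
  move=> hh h11 h22 eh.
  have := rank_three_idempotents hh h11 h22 n3 eh.
  have -> : N - h - 4%:M = N + (1%:M - h).
    have -> : 4 = - 1 :> F by rewrite -[RHS]addr0 -n5; ring.
    mxlin.
  move=> eqr.
  have r1 : (\rank h <= \rank (N - h)%R)%N.
    have -> : \rank h = \rank (h *m (N - h)).
      have -> : h *m (N - h) = - (h *m (1%:M - N)).
        by rewrite !mulmxBr hh mulmx1 opprB.
      by rewrite mxrank_opp mxrankMfree // row_free_unit; case/mulmx1_unit: U1.
    exact: mxrankM_maxr.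
  have r2 : (\rank (1%:M - h)%R <= \rank (N + (1%:M - h))%R)%N.
    have -> : \rank (1%:M - h) = \rank ((1%:M - h) *m (N + (1%:M - h))).
      have -> : (1%:M - h) *m (N + (1%:M - h)) = (1%:M - h) *m (1%:M + N).
        rewrite !(mulmxBl, mulmxBr, mulmxDl, mulmxDr, mul1mx, mulmx1) !mulmxN.
        rewrite !mulNmx hh; mxlin.
      by rewrite mxrankMfree // row_free_unit; case/mulmx1_unit: U2.
    exact: mxrankM_maxr.
  have r3 := mxrank_add N (- h); rewrite mxrank_opp in r3.
  have r4 := mxrank_add N (1%:M - h).
  have r5 := rank_idempotent_compl hh.
  move: eqr r1 r2 r3 r4 r5 rN (odd_double_half n).
  set x := \rank (N - h); set y := \rank (N + (1%:M - h))%R; set z := \rank (1%:M - h)%R.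
  by case: (odd n) => /=; lia.
have [on re] := key _ _ _ ee ff gg eN.
have [_ rf] := key _ _ _ ff ee gg (etrans eN (congr1 (+%R^~ g) (addrC e f))).
have [_ rg] := key _ _ _ gg ee ff (etrans eN (etrans (addrC _ g) (addrA _ _ _))).
have hn : n.+1 = (n./2.+1).*2 by rewrite -{1}(odd_double_half n) on.
have h x : (x + x = n.+1)%N -> x = n./2.+1 by lia.
have := congr1 mxtrace eN.
rewrite raddfB /= tN !raddfD /= mxtrace1 !mxtrace_idempotent // (h _ re) (h _ rf) (h _ rg).
rewrite hn -addnn natrD /a on; set q : F := (n./2.+1)%:R => eqn.
case/negP: n2; apply/eqP.
have -> : 2 = 1%:R * 2 - (q + q) - (q + q + q) + 5 * q by ring.
by rewrite eqn n5; ring.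
Qed.

Lemma no_three_idempotents (F : fieldType) n :
  (0 < n)%N -> 2 != 0 :> F -> 3 != 0 :> F ->
  exists M : 'M[F]_n, ~ sum_of_three_idempotents M.
Proof.
move=> n0 n2 n3; have [n5|n5] := eqVneq (5 : F) 0.
  exact: no_three_idempotents_char5.
case: n n0 => // n _.
exists (- 1%:M) => -[e [f [g [/mx_idempotentE ee /mx_idempotentE ff /mx_idempotentE gg eN]]]].
have key (h h1 h2 : 'M[F]_n.+1) : h *m h = h -> h1 *m h1 = h1 -> h2 *m h2 = h2 ->
    - 1%:M = h + h1 + h2 -> h = 1%:M.
  move=> hh h11 h22 eh.
  have n20 : 20 != 0 :> F.
    by have -> : 20 = 2 * 2 * 5 :> F by [ring]; rewrite !mulf_neq0.
  (* With [N = 0], [h] has the rank of [- h - 4], which is invertible since (-h - 4)(h - 5) = 20; an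
     invertible idempotent is 1. *)
  have /row_free_injr fr : row_free (0 - h).
    rewrite /row_free (rank_three_idempotents hh h11 h22 n3) ?sub0r //.
    rewrite -/(row_free _) row_free_unit.
    suff : (- h - 4%:M) *m (20^-1 *: (h - 5%:M)) = 1%:M by case/mulmx1_unit.
    rewrite -scalemxAr mulmxBl mulNmx !mulmxBr hh mul_mx_scalar !mul_scalar_mx.
    apply/(canLR (scalerK n20)); mxlin.
  have : h *m (0 - h) = 1%:M *m (0 - h) by rewrite !sub0r mulmxN hh mul1mx.
  exact: fr.
have e1 := key _ _ _ ee ff gg eN.
have f1 := key _ _ _ ff ee gg (etrans eN (congr1 (+%R^~ g) (addrC e f))).
have g1 := key _ _ _ gg ee ff (etrans eN (etrans (addrC _ g) (addrA _ _ _))).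
(* Three summands equal to 1 would give -1 = 3, hence 4 = 0. *)
have := congr1 (fun A : 'M_n.+1 => A 0 0) eN.
rewrite e1 f1 g1 !(mx_addE, mx_oppE, mx_scalarE) /= => E.
have : 2 * 2 = 0 :> F by rewrite -(subrr (- (1 * (1 : F)))) {1}E; ring.
by move/eqP; rewrite mulf_eq0 (negPf n2).
Qed.

(** * Descent to prime fields *)

Lemma deriv_prod (R : comNzRingType) (I : finType) (F : I -> {poly R}) :
  (\prod_i F i)^`() = \sum_i \prod_j (if j == i then (F j)^`() else F j).
Proof.
have gen (r : seq I) : uniq r -> (\prod_(i <- r) F i)^`() =
    \sum_(i <- r) \prod_(j <- r) (if j == i then (F j)^`() else F j).
  elim: r => [|a r IH]; first by rewrite !big_nil -polyC1 derivC.
  case/andP => nar ur; rewrite !big_cons derivM IH // eqxx; congr (_ + _).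
    congr (_ * _); rewrite !big_seq; apply: eq_bigr => j jr.
    by case: eqP jr nar => // -> ->.
  rewrite big_distrr /= !big_seq; apply: eq_bigr => i ir.
  by rewrite big_cons; case: eqP ir nar => // -> ->.
by rewrite -[index_enum _]enumT gen // enum_uniq.
Qed.

(** Jacobi's formula: the Leibniz rule gives one determinant per row, with that row differentiated,
    and each is expanded along that row. *)
Lemma deriv_det (R : comNzRingType) n (A : 'M[{poly R}]_n) :
  (\det A)^`() = \tr (map_mx (@deriv R) A *m \adj A).
Proof.
pose B i : 'M[{poly R}]_n :=
  \matrix_(k, j) if k == i then (A k j)^`() else A k j.
transitivity (\sum_i \det (B i)).
  rewrite /determinant raddf_sum /= exchange_big /=; apply: eq_bigr => s _.
  rewrite -mulr_sumr -(rmorph_sign (@polyC R)).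
  rewrite mul_polyC derivZ -mul_polyC; congr (_ * _).
  by rewrite deriv_prod; apply: eq_bigr => i _; apply: eq_bigr => j _; rewrite mxE.
rewrite /mxtrace; apply: eq_bigr => i _.
rewrite (expand_det_row _ i) mxE; apply: eq_bigr => j _.
rewrite !mxE eqxx; congr (_ * _); rewrite /cofactor. congr (_ * \det _).
by apply/matrixP => k l; rewrite !mxE eq_sym (negPf (neq_lift _ _)).
Qed.

(* D(X) = det(1 + X E) satisfies (1 + X) D' = (tr E) D, whence
   (k + 1) d_{k+1} = (tr E - k) d_k for its coefficients, with d_0 = 1. *)
Lemma mxtrace_idempotent_prod (R : comNzRingType) n (E : 'M[R]_n) :
  E *m E = E -> \prod_(i < n.+1) (\tr E - i%:R) = 0.
Proof.
move=> EE; pose P := map_mx polyC E.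
have PP : P *m P = P by rewrite -map_mxM EE.
pose A : 'M_n := 1%:M + 'X *: P; pose D := \det A.
have dA : map_mx (@deriv R) A = P.
  apply/matrixP => i j; rewrite !mxE derivD derivM derivX derivC mulr0 addr0.
  by rewrite mul1r -[1]polyC1 -polyCMn derivC add0r.
have D1 : (1 + 'X) * D^`() = (\tr E) *: D.
  rewrite deriv_det dA -mxtraceZ scalemxAl.
  have -> : (1 + 'X) *: P = P *m A.
    by rewrite mulmxDr mulmx1 -scalemxAr PP scalerDl scale1r.
  rewrite -mulmxA mul_mx_adj mul_mx_scalar mxtraceZ mulrC -mul_polyC.
  by congr (_ * _); rewrite trace_map_mx.
have D0 : D`_0 = 1.
  rewrite -horner_coef0 -horner_evalE -det_map_mx.
  suff -> : map_mx (horner_eval 0) A = 1%:M by rewrite det1.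
  apply/matrixP => i j; rewrite !mxE horner_evalE hornerD hornerM hornerX mul0r addr0.
  by rewrite hornerMn hornerC.
(* [D] is a signed sum of products of n entries of degree at most 1, so the recurrence must reach
   zero. *)
have Dn : D`_n.+1 = 0.
  apply: nth_default; rewrite /D /determinant; apply: (leq_trans (size_sum _ _ _)).
  apply/bigmax_leqP => s _; rewrite -(rmorph_sign (@polyC R)) mul_polyC; apply: (leq_trans (size_scale_leq _ _)).
  apply: (leq_trans (size_prod_leq _ _)).
  rewrite card_ord leq_subLR addnS ltnS addnn -muln2.
  rewrite -[X in (_ <= X * 2)%N]card_ord -sum_nat_const; apply: leq_sum => i _; rewrite !mxE.
  apply: (leq_trans (size_polyD _ _)); rewrite geq_max mulrC; apply/andP; split.
    by case: eqP => _; rewrite ?size_poly1 ?size_poly0.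
  by rewrite mul_polyC (leq_trans (size_scale_leq _ _)) ?size_polyX.
have rec i : D`_i.+1 * i.+1%:R = (\tr E - i%:R) * D`_i.
  have := congr1 (fun p : {poly R} => p`_i) D1.
  rewrite mulrDl mul1r coefD coefZ coefXM coef_deriv mulr_natr mulrBl => <-.
  case: i => [|i] /=; first by rewrite mul0r subr0 addr0.
  by rewrite coef_deriv mulr_natl addrK.
have prodE k : \prod_(i < k) (\tr E - i%:R) = k`!%:R * D`_k.
  elim: k => [|k IH]; first by rewrite big_ord0 D0 mulr1.
  rewrite big_ord_recr /= IH -mulrA [D`_k * _]mulrC -rec factS natrM; ring.
by rewrite prodE Dn mulr0.
Qed.

(** Multiplied by [c], the partial products start at [c] and end at 0; [d] is one that is nonzero
    just before the next vanishes. *)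
Lemma prod_sub_nat_torsion (R : comPzRingType) (x c : R) N :
  c != 0 -> c * \prod_(i < N) (x - i%:R) = 0 ->
  exists d k, [/\ (k < N)%N, c * d != 0 & c * d * (x - k%:R) = 0].
Proof.
move=> c0; elim: N => [|N IH]; first by rewrite big_ord0 mulr1 => /eqP; rewrite (negPf c0).
rewrite big_ord_recr /= mulrA => E.
have [/IH [d [k [kN cd cdk]]]|ne] := eqVneq (c * \prod_(i < N) (x - i%:R)) 0.
  by exists d, k; rewrite ltnS ltnW.
by exists (\prod_(i < N) (x - i%:R)), N.
Qed.

Lemma mxtrace_idempotent_torsion (R : comPzRingType) n (E : 'M[R]_n) (c : R) :
  E *m E = E -> c != 0 ->
  exists d k, [/\ (k <= n)%N, c * d != 0 & c * d * (\tr E - k%:R) = 0].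
Proof.
move=> EE c0.
(* The trace identity lives over nonzero rings; [c != 0] makes R one of them. *)
have nz : (1 : R) != 0 by apply: contra_neq c0 => r1; rewrite -[c]mulr1 r1 mulr0.
pose mx := GRing.PzSemiRing_isNonZero.Build R nz.
pose R' : comNzRingType := HB.pack_for comNzRingType R mx.
apply: (@prod_sub_nat_torsion R (\tr E) c n.+1 c0).
by rewrite (@mxtrace_idempotent_prod R' n E EE) mulr0.
Qed.

(** [x] is the trace of [x *: delta_mx 0 0]; the multiple of [c] is refined once for each of the
    three idempotents. *)
Lemma three_idempotents_torsion (R : comPzRingType) n (x c : R) :
  (forall M : 'M[R]_n.+1, sum_of_three_idempotents M) -> c != 0 ->
  exists d k, [/\ (k <= n.+1 * 3)%N, c * d != 0 & c * d * (x - k%:R) = 0].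
Proof.
move=> hM c0.
have [e [f [g [/mx_idempotentE ee /mx_idempotentE ff /mx_idempotentE gg E]]]] :=
  hM (x *: delta_mx 0 0).
have [d1 [k1 [l1 n1 E1]]] := mxtrace_idempotent_torsion ee c0.
have [d2 [k2 [l2 n2 E2]]] := mxtrace_idempotent_torsion ff n1.
have [d3 [k3 [l3 n3 E3]]] := mxtrace_idempotent_torsion gg n2.
exists (d1 * d2 * d3), (k1 + k2 + k3)%N; rewrite !mulrA; split=> //; first by lia.
have -> : x = \tr e + \tr f + \tr g.
  rewrite -!raddfD /= -E mxtraceZ /mxtrace (bigD1 0) //= big1 ?addr0 ?mxE ?mulr1 //.
  by move=> i /negPf ni; rewrite mxE ni.
rewrite !natrD.
have -> : c * d1 * d2 * d3 * (\tr e + \tr f + \tr g - (k1%:R + k2%:R + k3%:R)) =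
  c * d1 * (\tr e - k1%:R) * d2 * d3 + c * d1 * d2 * (\tr f - k2%:R) * d3 +
  c * d1 * d2 * d3 * (\tr g - k3%:R) by ring.
by rewrite E1 E2 E3 !mul0r !addr0.
Qed.

Lemma three_idempotents_torsion_seq (R : comPzRingType) n (s : seq R) (c : R) :
  (forall M : 'M[R]_n.+1, sum_of_three_idempotents M) -> c != 0 ->
  exists2 d, c * d != 0 & {in s, forall x, exists k, c * d * x = c * d * k%:R}.
Proof.
move=> hM; elim: s c => [|x s IH] c c0; first by exists 1; rewrite ?mulr1.
have [d [k [_ cd E]]] := three_idempotents_torsion x hM c0.
have [d' cd' H] := IH _ cd; exists (d * d'); first by rewrite mulrA.
have -> : c * (d * d') = c * d * d' by rewrite mulrA.
move=> y; rewrite inE => /orP[/eqP->|/H //]; exists k.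
have -> : c * d * d' * x = c * d * (x - k%:R) * d' + c * d * d' * k%:R by ring.
by rewrite E mul0r add0r.
Qed.

Lemma nat_torsion_prime (R : comPzRingType) (c : R) (m : nat) :
  (0 < m)%N -> c != 0 -> c * m%:R = 0 ->
  exists p d, [/\ prime p, c * d != 0 & c * d * p%:R = 0].
Proof.
elim/ltn_ind: m c => m IH c m0 c0 E.
have m1 : (1 < m)%N.
  by case: m m0 E {IH} => [|[|]] // _; rewrite mulr1 => /eqP; rewrite (negPf c0).
have pp := pdiv_prime m1; have pm := divnK (pdiv_dvd m).
have [Z|nz] := eqVneq (c * (m %/ pdiv m)%:R) 0.
  by apply: IH Z => //; [rewrite ltn_Pdiv ?prime_gt1|rewrite divn_gt0 ?pdiv_gt0 ?pdiv_leq].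
by exists (pdiv m), (m %/ pdiv m)%:R; split=> //; rewrite -mulrA -natrM pm.
Qed.

(** For x an integer m above the bound on k, the positive integer m - k kills a nonzero multiple of
    [c]. *)
Lemma prime_torsion (R : comPzRingType) n (c : R) :
  (forall M : 'M[R]_n.+1, sum_of_three_idempotents M) -> c != 0 ->
  exists p d, [/\ prime p, c * d != 0 & c * d * p%:R = 0].
Proof.
move=> hM c0; pose m := (n.+1 * 3).+1.
have [d [k [km cd E]]] := three_idempotents_torsion m%:R hM c0.
have [||p [d' [pp cd' E']]] := @nat_torsion_prime R (c * d) (m - k) _ cd.
- by rewrite subn_gt0.
- by rewrite natrB // ltnW.
by exists p, (d * d'); rewrite mulrA.
Qed.

(** * Reduction modulo p on multiples killed by p *)

Lemma prime_torsion_dvd (R : comPzRingType) (c : R) p k :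
  prime p -> c != 0 -> c * p%:R = 0 -> (c * k%:R == 0) = (p %| k)%N.
Proof.
move=> pp c0 cp; apply/eqP/idP => [ck|/dvdnP[q ->]]; last first.
  by rewrite natrM mulrCA cp mulr0.
rewrite -[(p %| k)%N]negbK -prime_coprime //; apply/negP => cop.
have [u v uv _] := egcdnP k (prime_gt0 pp).
have := congr1 (fun a : nat => c * a%:R) uv.
rewrite (eqP cop) natrD !natrM mulrDr mulr1 mulrCA cp mulrCA ck !mulr0 add0r => /esym.
exact/eqP.
Qed.

(** Not a morphism in general; for prime p it respects sums and products after multiplication by any
    c with p c = 0. *)
Definition lift_Fp (R : pzRingType) p (z : 'F_p) : R := (z : nat)%:R.

Lemma lift_Fp_nat (R : comPzRingType) (c : R) p k :
  prime p -> c * p%:R = 0 -> c * lift_Fp R (k%:R : 'F_p) = c * k%:R.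
Proof.
move=> pp cp; rewrite /lift_Fp val_Fp_nat // [in RHS](divn_eq k p).
by rewrite natrD natrM mulrDr mulrCA cp mulr0 add0r.
Qed.

Lemma lift_FpD (R : comPzRingType) (c : R) p (z w : 'F_p) :
  prime p -> c * p%:R = 0 ->
  c * lift_Fp R (z + w) = c * (lift_Fp R z + lift_Fp R w).
Proof.
move=> pp cp; rewrite -[z in LHS]natr_Zp -[w in LHS]natr_Zp -natrD.
by rewrite lift_Fp_nat // natrD.
Qed.

Lemma lift_FpM (R : comPzRingType) (c : R) p (z w : 'F_p) :
  prime p -> c * p%:R = 0 ->
  c * lift_Fp R (z * w) = c * (lift_Fp R z * lift_Fp R w).
Proof.
move=> pp cp; rewrite -[z in LHS]natr_Zp -[w in LHS]natr_Zp -natrM.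
by rewrite lift_Fp_nat // natrM.
Qed.

Lemma lift_Fp_sum (R : comPzRingType) (c : R) p (I : finType) (F : I -> 'F_p) :
  prime p -> c * p%:R = 0 ->
  c * lift_Fp R (\sum_i F i) = c * \sum_i lift_Fp R (F i).
Proof.
move=> pp cp; apply: (big_ind2 (fun z x => c * lift_Fp R z = c * x)) => //.
by move=> z x w y hz hw; rewrite lift_FpD // !mulrDr hz hw.
Qed.

Lemma lift_Fp_inj (R : comPzRingType) (c : R) p (z w : 'F_p) :
  prime p -> c != 0 -> c * p%:R = 0 ->
  c * lift_Fp R z = c * lift_Fp R w -> z = w.
Proof.
move=> pp c0 cp zw; apply/eqP; rewrite -subr_eq0; apply/eqP.
have : c * lift_Fp R (z - w) = 0.
  apply: (addIr (c * lift_Fp R w)).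
  by rewrite add0r -mulrDr -lift_FpD // subrK.
move/eqP; rewrite /lift_Fp (@prime_torsion_dvd R c p) // => /dvdnP[q qE].
by rewrite -[z - w]natr_Zp qE natrM pchar_Fp_0 // mulr0.
Qed.

(** Decompose a lift of [M] over R and pass to a nonzero multiple [b] of [c] on which all entries of
    the idempotents are integers. Read modulo p, these decompose [M], since [b] detects equality in
    F_p. *)
Lemma three_idempotents_Fp (R : comPzRingType) n (c : R) p :
  (forall M : 'M[R]_n.+1, sum_of_three_idempotents M) ->
  prime p -> c != 0 -> c * p%:R = 0 ->
  forall M : 'M['F_p]_n.+1, sum_of_three_idempotents M.
Proof.
move=> hM pp c0 cp M.
have [e [f [g [/mx_idempotentE ee /mx_idempotentE ff /mx_idempotentE gg E]]]] :=
  hM (map_mx (@lift_Fp R p) M).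
pose entries (A : 'M[R]_n.+1) := [seq A t.1 t.2 | t : 'I_n.+1 * 'I_n.+1].
have entriesP (A : 'M[R]_n.+1) i j : A i j \in entries A.
  by apply/mapP; exists (i, j); rewrite ?mem_enum.
have [d cd H] := three_idempotents_torsion_seq (entries e ++ entries f ++ entries g) hM c0.
move: cd H; set b := c * d => b0 H.
have bp : b * p%:R = 0 by rewrite /b mulrAC cp mul0r.
have red (A : 'M[R]_n.+1) : {subset entries A <= entries e ++ entries f ++ entries g} ->
    {A' : 'M['F_p]_n.+1 | forall i j, b * A i j = b * lift_Fp R (A' i j)}.
  move=> sA.
  have h i j : {k : nat | b * A i j = b * k%:R} by apply: cid; exact/H/sA.
  exists (\matrix_(i, j) (sval (h i j))%:R) => i j; rewrite mxE lift_Fp_nat //.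
  by case: (h i j).
have idem (A : 'M[R]_n.+1) (A' : 'M['F_p]_n.+1) : A *m A = A ->
    (forall i j, b * A i j = b * lift_Fp R (A' i j)) -> A' *m A' = A'.
  move=> AA hA; apply/matrixP => i j; apply: (lift_Fp_inj pp b0 bp).
  rewrite -hA -[in RHS]AA !mxE lift_Fp_sum // !mulr_sumr; apply: eq_bigr => k _.
  by rewrite lift_FpM // [LHS]mulrA -hA mulrAC -hA; ring.
have [|e' he] := red e; first by move=> x; rewrite mem_cat => ->.
have [|f' hf] := red f; first by move=> x; rewrite !mem_cat => ->; rewrite orbT.
have [|g' hg] := red g; first by move=> x; rewrite !mem_cat => ->; rewrite !orbT.
exists e', f', g'; split.
- exact/mx_idempotentE/(idem e).
- exact/mx_idempotentE/(idem f).
- exact/mx_idempotentE/(idem g).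
apply/matrixP => i j; apply: (lift_Fp_inj pp b0 bp).
have := congr1 (fun A : 'M_n.+1 => b * A i j) E.
rewrite mx_addE mx_addE mxE => Eij; apply: (etrans Eij).
rewrite !mx_addE; apply: esym.
apply: (etrans (lift_FpD (e' i j + f' i j) (g' i j) pp bp)).
by rewrite mulrDr (lift_FpD (e' i j) (f' i j) pp bp) !mulrDr he hf hg.
Qed.

Lemma three_idempotents_cube (R : comPzRingType) n :
  (forall x : R, nilpotent_elt x -> x = 0) ->
  (forall M : 'M[R]_n.+1, sum_of_three_idempotents M) -> identity_cube R.
Proof.
move=> hR hM x; apply/eqP; rewrite -subr_eq0; apply: contraT => y0.
set y := x ^+ 3 - x in y0.
have [d1 [k [_ c1 E1]]] := three_idempotents_torsion x hM y0.
have [p [d2 [pp c2 E2]]] := prime_torsion hM c1.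
set c := y * d1 * d2 in c2 E2.
have ck : c * y = c * (k ^ 3 - k)%:R.
  have kk : (k <= k ^ 3)%N by rewrite !expnS muln1; case: (k) => // q; nia.
  rewrite natrB // natrX /y.
  have -> : c * (x ^+ 3 - x) = y * d1 * (x - k%:R) * d2 * (x ^+ 2 + x * k%:R + k%:R ^+ 2 - 1) + c * (k%:R ^+ 3 - k%:R).
    by rewrite /c; ring.
  by rewrite E1 !mul0r add0r.
(* If c y = 0 then c^2 = 0, as [c] is a multiple of [y], and reducedness gives c = 0. *)
have cy : c * y != 0.
  apply: contra c2 => /eqP cy0; apply/eqP/hR; exists 2.
  have -> : c ^+ 2 = c * y * (d1 * d2) by rewrite /c; ring.
  by rewrite cy0 mul0r.
have pk : ~~ (p %| k ^ 3 - k)%N by rewrite -(prime_torsion_dvd _ pp c2 E2) -ck.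
have p23 : ~~ (p %| 2)%N && ~~ (p %| 3)%N.
  rewrite -negb_or; apply: contra pk => p6.
  (* (k - 1) k (k + 1) is divisible by 6, which excludes p = 2 and p = 3. *)
  have -> : (k ^ 3 - k = 'C(k.+1, 3) * 6)%N.
    rewrite -[6%N]/(3`!) bin_ffact !ffactnS ffactn0 muln1 /=.
    by case: k {E1 ck} => [|k] //=; rewrite expnS; nia.
  by apply: dvdn_mull; case/orP: p6 => /dvdn_trans; apply.
have Fnz m : ~~ (p %| m)%N -> (m%:R : 'F_p) != 0.
  by apply: contra => /eqP /(congr1 val) /=; rewrite val_Fp_nat // => /eqP.
have [M []] := @no_three_idempotents 'F_p n.+1 isT (Fnz 2 (proj1 (andP p23))) (Fnz 3 (proj2 (andP p23))).
exact: three_idempotents_Fp hM pp c2 E2 M.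
Qed.

(** * Cyclic decomposition and matrices over F_2 and F_3 *)

Lemma three_idempotents_retract (R : comPzRingType) m n (P : 'M[R]_(m, n))
    (Q : 'M[R]_(n, m)) (A : 'M[R]_m) :
  P *m Q = 1%:M -> sum_of_three_idempotents A ->
  sum_of_three_idempotents (Q *m A *m P).
Proof.
move=> PQ [e [f [g [/mx_idempotentE ee /mx_idempotentE ff /mx_idempotentE gg ->]]]].
have idem h : h *m h = h -> idempotent_elt (Q *m h *m P).
  move=> hh; apply/mx_idempotentE.
  by rewrite !mulmxA -(mulmxA (Q *m h) P Q) PQ mulmx1 -(mulmxA Q h h) hh.
exists (Q *m e *m P), (Q *m f *m P), (Q *m g *m P); split; try exact: idem.
by rewrite !mulmxDr !mulmxDl.
Qed.

Lemma three_idempotents_block (R : comPzRingType) m n (A : 'M[R]_m) (B : 'M[R]_n) :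
  sum_of_three_idempotents A -> sum_of_three_idempotents B ->
  sum_of_three_idempotents (block_mx A 0 0 B : 'M[R]_(m + n)).
Proof.
move=> [e [f [g [/mx_idempotentE ee /mx_idempotentE ff /mx_idempotentE gg ->]]]].
move=> [e' [f' [g' [/mx_idempotentE ee' /mx_idempotentE ff' /mx_idempotentE gg' ->]]]].
have idem (h : 'M[R]_m) (h' : 'M[R]_n) : h *m h = h -> h' *m h' = h' ->
    idempotent_elt (block_mx h 0 0 h' : 'M[R]_(m + n)).
  move=> hh hh'; apply/mx_idempotentE.
  by rewrite mulmx_block !mulmx0 !mul0mx !addr0 !add0r hh hh'.
exists (block_mx e 0 0 e'), (block_mx f 0 0 f'), (block_mx g 0 0 g').
by split; try exact: idem; rewrite !add_block_mx !addr0.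
Qed.

Lemma three_idempotents_direct (F : fieldType) m1 m2 n (M : 'M[F]_n)
    (U : 'M[F]_(m1, n)) (W : 'M[F]_(m2, n)) :
  stablemx U M -> stablemx W M -> (U :&: W)%MS = 0 -> (\rank U + \rank W = n)%N ->
  (forall A : 'M[F]_(\rank U), sum_of_three_idempotents A) ->
  (forall A : 'M[F]_(\rank W), sum_of_three_idempotents A) ->
  sum_of_three_idempotents M.
Proof.
move=> sU sW UW0 rUW TU TW.
have [A eA] : exists A, row_base U *m M = A *m row_base U.
  by apply/submxP; rewrite (eqmxMr M (eq_row_base U)) eq_row_base.
have [B eB] : exists B, row_base W *m M = B *m row_base W.
  by apply/submxP; rewrite (eqmxMr M (eq_row_base W)) eq_row_base.
pose P := col_mx (row_base U) (row_base W).
have rP : \rank P = n.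
  rewrite -addsmxE (adds_eqmx (eq_row_base U) (eq_row_base W)).
  by rewrite mxrank_disjoint_sum.
have fP : row_full P by rewrite /row_full rP.
have fP' : row_free P by rewrite /row_free rP rUW.
have PM : P *m M = block_mx A 0 0 B *m P.
  by rewrite mul_col_mx mul_block_col !mul0mx addr0 add0r eA eB.
have -> : M = pinvmx P *m block_mx A 0 0 B *m P.
  by rewrite -mulmxA -PM mulmxA mulVpmx // mul1mx.
apply: three_idempotents_retract; first exact: mulmxVp.
exact: three_idempotents_block.
Qed.

(** Fitting's lemma: a positive power [K] of [N] of least rank has the rank of its square, so its
    image meets its kernel trivially. *)
Lemma fitting_split (F : fieldType) n (M N : 'M[F]_n.+1) :
  comm_mx M N -> (forall k, N ^+ k != 0) -> N \notin unitmx ->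
  exists K : 'M[F]_n.+1,
    [/\ comm_mx M K, (0 < \rank K < n.+1)%N & (K :&: kermx K)%MS = 0].
Proof.
move=> cMN nn nu.
have h : exists r, `[< exists i, r = \rank (N ^+ i.+1) >].
  by exists (\rank (N ^+ 1)); apply/asboolP; exists 0%N.
case: (ex_minnP h) => r /asboolP[i ->] rmin; set K := N ^+ i.+1.
exists K; split.
- exact: commrX.
- rewrite lt0n mxrank_eq0 nn /= ltn_neqAle rank_leq_row andbT.
  apply: contra nu => fK.
  have : K \in unitmx by rewrite -row_free_unit.
  by rewrite /K exprS unitmx_mul => /andP[].
- apply/eqP; rewrite -mxrank_eq0; have := mxrank_mul_ker K K.
  have : (\rank K <= \rank (K *m K))%N.
    rewrite -[K *m K]/(K * K) -exprD addSn; apply: rmin.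
    by apply/asboolP; exists (i + i.+1)%N.
  lia.
Qed.

(** [p] generates the annihilator of [v] when X acts by [M]; it is not normalised to be monic. *)
Definition local_minpoly (F : fieldType) n (M : 'M[F]_n.+1) (v : 'rV[F]_n.+1)
    (p : {poly F}) :=
  p != 0 /\ forall q, (v *m horner_mx M q == 0) = (p %| q).

Lemma local_minpoly_ex (F : fieldType) n (M : 'M[F]_n.+1) (v : 'rV[F]_n.+1) :
  exists p, local_minpoly M v p.
Proof.
have h : exists k, `[< exists p, [/\ p != 0, v *m horner_mx M p = 0 & size p = k] >].
  exists (size (char_poly M)); apply/asboolP; exists (char_poly M).
  by rewrite monic_neq0 ?char_poly_monic // Cayley_Hamilton mulmx0.
case: (ex_minnP h) => k /asboolP[p [p0 vp sp]] kmin; exists p; split=> // q.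
have qE : v *m horner_mx M q = v *m horner_mx M (q %% p).
  rewrite {1}(divp_eq q p) rmorphD rmorphM /= mulmxDr.
  by rewrite -(comm_horner_mx2 M p (q %/ p)) -mulmxE mulmxA vp mul0mx add0r.
rewrite qE /dvdp; apply/eqP/eqP => [vr|->]; last by rewrite rmorph0 mulmx0.
apply/eqP; apply: contraT => r0.
have /kmin : `[< exists p', [/\ p' != 0, v *m horner_mx M p' = 0 & size p' = size (q %% p)] >].
  by apply/asboolP; exists (q %% p).
by rewrite -sp leqNgt ltn_modp p0.
Qed.

(* If every matrix commuting with M is nilpotent or invertible, then local
   minimal polynomials are totally ordered by divisibility: after removing the
   gcd, the cofactors are coprime, so one of them is invertible at M. *)
Lemma local_minpoly_total (F : fieldType) n (M : 'M[F]_n.+1) u v (p q : {poly F}) :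
  (forall N, comm_mx M N -> (exists k, N ^+ k = 0) \/ N \in unitmx) ->
  local_minpoly M u p -> local_minpoly M v q -> p %| q \/ q %| p.
Proof.
move=> hM [p0 hp] [q0 hq]; pose g := gcdp p q.
have g0 : g != 0 by rewrite gcdp_eq0 negb_and p0.
have pE : p = p %/ g * g by rewrite divpK // dvdp_gcdl.
have qE : q = q %/ g * g by rewrite divpK // dvdp_gcdr.
have cop : coprimep (p %/ g) (q %/ g) by rewrite coprimep_div_gcd ?p0.
have key (w : 'rV_n.+1) (a b : {poly F}) : horner_mx M a \in unitmx ->
    w *m horner_mx M (a * b) = 0 -> w *m horner_mx M b = 0.
  move=> ua; rewrite rmorphM /= (comm_horner_mx2 M a b) -mulmxE mulmxA => /(congr1 (mulmx^~ (invmx (horner_mx M a)))).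
  by rewrite mulmxK // mul0mx.
have hor a : (exists k, horner_mx M a ^+ k = 0) \/ horner_mx M a \in unitmx.
  by apply/hM/comm_mx_horner.
case: (hor (p %/ g)) => [[k pk]|up]; last first.
  left; apply: dvdp_trans (dvdp_gcdr p q); rewrite -hp; apply/eqP/(key _ (p %/ g)) => //.
  by rewrite -pE; apply/eqP; rewrite hp.
case: (hor (q %/ g)) => [[l ql]|uq]; last first.
  right; apply: dvdp_trans (dvdp_gcdl p q); rewrite -hq; apply/eqP/(key _ (q %/ g)) => //.
  by rewrite -qE; apply/eqP; rewrite hq.
have /Bezout_eq1_coprimepP[[a b] /= ab] : coprimep ((p %/ g) ^+ k) ((q %/ g) ^+ l).
  by rewrite coprimep_expl // coprimep_expr.
have := congr1 (horner_mx M) ab.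
rewrite rmorphD !rmorphM !rmorphXn /= pk ql !mulr0 addr0 rmorph1 => /esym/eqP.
by rewrite oner_eq0.
Qed.

(** Take [u] whose local minimal polynomial has maximal degree. By total ordering, those of the
    basis vectors divide it. *)
Lemma cyclic_minpoly_ex (F : fieldType) n (M : 'M[F]_n.+1) :
  (forall N, comm_mx M N -> (exists k, N ^+ k = 0) \/ N \in unitmx) ->
  exists u p, local_minpoly M u p /\ horner_mx M p = 0.
Proof.
move=> hM; have [p0 hp0] := local_minpoly_ex M 0.
have h : exists k, `[< exists v p, local_minpoly M v p /\ size p = k >].
  by exists (size p0); apply/asboolP; exists 0, p0.
have bnd k : `[< exists v p, local_minpoly M v p /\ size p = k >] -> (k <= n.+2)%N.
  move=> /asboolP[v [p [[p_neq0 hp] <-]]]; rewrite -(size_char_poly M) dvdp_leq //.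
    by rewrite monic_neq0 ?char_poly_monic.
  by rewrite -hp Cayley_Hamilton mulmx0.
case: (ex_maxnP h bnd) => k /asboolP[u [p [hp sp]]] kmax.
exists u, p; split=> //; apply/row_matrixP => i; rewrite row0 rowE.
have [q hq] := local_minpoly_ex M (delta_mx 0 i).
apply/eqP; rewrite (proj2 hq).
have sq : (size q <= size p)%N.
  by rewrite sp; apply: kmax; apply/asboolP; exists (delta_mx 0 i), q.
case: (local_minpoly_total hM hp hq) => // pq.
have : p %= q by rewrite -dvdp_size_eqp // eqn_leq sq dvdp_leq // (proj1 hq).
by rewrite /eqp => /andP[].
Qed.

(** * Krylov bases and complements of cyclic subspaces *)

Lemma monic_family_free (F : fieldType) (w : nat -> {poly F}) (a : nat -> F) d :
  (forall i, size (w i) = i.+1) -> \sum_(i < d) a i *: w i = 0 ->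
  forall i, (i < d)%N -> a i = 0.
Proof.
move=> sw; elim: d => // d IH; rewrite big_ord_recr /= => E.
have sl : (size (\sum_(i < d) a i *: w i)%R <= d)%N.
  apply: (leq_trans (size_sum _ _ _)); apply/bigmax_leqP => i _.
  by rewrite (leq_trans (size_scale_leq _ _)) ?sw.
have ad : a d = 0.
  have := congr1 (fun r : {poly F} => r`_d) E.
  rewrite coefD coefZ coef0 nth_default // add0r => /eqP; rewrite mulf_eq0.
  have := lead_coef_eq0 (w d); rewrite lead_coefE sw /= => ->.
  by rewrite -size_poly_eq0 sw orbF => /eqP.
move: E; rewrite ad scale0r addr0 => E i; rewrite ltnS leq_eqVlt => /predU1P[->//|].
exact: IH.
Qed.

(** The polynomials are a parameter: powers of X span the cyclic subspace, products of X - c_j give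
    the Hessenberg basis. *)
Definition krylov_mx (F : fieldType) n (M : 'M[F]_n.+1) (u : 'rV[F]_n.+1)
    (w : nat -> {poly F}) d : 'M[F]_(d, n.+1) :=
  \matrix_(i < d) (u *m horner_mx M (w i)).

Lemma mul_krylov_mx (F : fieldType) n (M : 'M[F]_n.+1) u w d (a : 'rV[F]_d) :
  a *m krylov_mx M u w d = u *m horner_mx M (\sum_(i < d) a 0 i *: w i).
Proof.
rewrite raddf_sum mulmx_sumr mulmx_sum_row; apply: eq_bigr => i _.
by rewrite rowK /= linearZ /= -scalemxAr.
Qed.

Lemma krylov_mx_free (F : fieldType) n (M : 'M[F]_n.+1) u (w : nat -> {poly F}) d :
  (forall i, size (w i) = i.+1) ->
  (forall q : {poly F}, (size q <= d)%N -> u *m horner_mx M q = 0 -> q = 0) ->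
  row_free (krylov_mx M u w d).
Proof.
move=> sw hu; apply: inj_row_free => a; rewrite mul_krylov_mx => /hu.
pose a' i := if insub i is Some j then a 0 j else 0.
have aE (i : 'I_d) : a 0 i = a' i by rewrite /a' valK.
have sumE : \sum_(i < d) a 0 i *: w i = \sum_(i < d) a' i *: w i.
  by apply: eq_bigr => i _; rewrite aE.
rewrite sumE => H; apply/rowP => i; rewrite mxE aE.
apply: (monic_family_free sw) (ltn_ord i); apply: H.
apply: (leq_trans (size_sum _ _ _)); apply/bigmax_leqP => j _.
by rewrite (leq_trans (size_scale_leq _ _)) ?sw.
Qed.

Lemma horner_mx_mod (F : fieldType) n (M : 'M[F]_n.+1) (p q : {poly F}) :
  horner_mx M p = 0 -> horner_mx M q = horner_mx M (q %% p).
Proof.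
by move=> Mp; rewrite {1}(divp_eq q p) rmorphD rmorphM /= Mp mulr0 add0r.
Qed.

(* A functional c that vanishes on u M^i for i < d - 1 but not on u M^(d-1)
   makes the largest M-stable subspace of its kernel a complement of the cyclic
   subspace generated by u. *)
Lemma cyclic_complement (F : fieldType) n (M : 'M[F]_n.+1) u (p : {poly F}) d :
  local_minpoly M u p -> horner_mx M p = 0 -> size p = d.+2 ->
  exists2 W : 'M[F]_n.+1, stablemx W M &
   [/\ row_free (krylov_mx M u (fun i => 'X^i) d.+1),
       (krylov_mx M u (fun i => 'X^i) d.+1 :&: W)%MS = 0,
       stablemx (krylov_mx M u (fun i => 'X^i) d.+1) M &
       (\rank (krylov_mx M u (fun i => 'X^i) d.+1) + \rank W = n.+1)%N].
Proof.
move=> [p0 hp] Mp sp; set U := krylov_mx _ _ _ _.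
have hu (q : {poly F}) : (size q <= d.+1)%N -> u *m horner_mx M q = 0 -> q = 0.
  move=> sq /eqP; rewrite hp => /dvdp_leq le; apply/eqP; apply: contraT => /le.
  by rewrite sp ltnNge sq.
have small (q : {poly F}) : (size (q %% p)%R <= d.+1)%N by rewrite -ltnS -sp ltn_modp.
have polyE (q : {poly F}) : (size q <= d.+1)%N -> q = \sum_(i < d.+1) (\row_j q`_(j : 'I_d.+1)) 0 i *: 'X^i.
  move=> sq; rewrite -[LHS](take_poly_id sq) /take_poly.
  by rewrite poly_def; apply: eq_bigr => i _; rewrite mxE.
have fU : row_free U by apply: krylov_mx_free => // i; rewrite size_polyXn.
have inU (q : {poly F}) : (size q <= d.+1)%N -> u *m horner_mx M q = (\row_j q`_(j : 'I_d.+1)) *m U.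
  by move=> sq; rewrite mul_krylov_mx -polyE.
(* On the span of [U], this is the coordinate along [u M^d]. *)
pose c := pinvmx U *m delta_mx (ord_max : 'I_d.+1) (0 : 'I_1).
have hc (q : {poly F}) : (size q <= d.+1)%N -> u *m horner_mx M q *m c = (q`_d)%:M.
  move=> sq; rewrite inU // /c mulmxA mulmxKp //; apply/matrixP => i j.
  rewrite !mxE (bigD1 ord_max) //= big1 => [|k kn]; last by rewrite !mxE (negPf kn) mulr0.
  by rewrite !mxE !ord1 !eqxx mulr1 addr0.
(* Since p(M) = 0 with p of degree d + 1, the d + 1 columns M^j c test all polynomials in [M]; hence
   the kernel is stable. *)
pose L : 'M_(n.+1, d.+1) := \matrix_(k, j) (M ^+ j *m c) k 0.
have LP m (X : 'M_(m, n.+1)) : X *m L = 0 <-> forall q, X *m horner_mx M q *m c = 0.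
  have XL i j : (X *m L) i j = (X *m horner_mx M 'X^j *m c) i 0.
    by rewrite rmorphXn /= horner_mx_X -mulmxA !mxE; apply: eq_bigr => k _; rewrite !mxE.
  split=> [X0 q|H]; last by apply/matrixP => i j; rewrite XL H !mxE.
  rewrite (horner_mx_mod q Mp) (polyE _ (small q)) raddf_sum mulmx_sumr mulmx_suml.
  rewrite big1 // => i _; rewrite /= linearZ /= -scalemxAr -scalemxAl.
  suff -> : X *m horner_mx M 'X^i *m c = 0 by rewrite scaler0.
  by apply/matrixP => k l; rewrite ord1 -XL X0 !mxE.
pose W := kermx L.
have sW : stablemx W M.
  apply/sub_kermxP/LP => q; rewrite -(mulmxA W).
  have -> : M *m horner_mx M q = horner_mx M ('X * q) by rewrite rmorphM /= horner_mx_X.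
  by move: ('X * q); apply/LP; exact: mulmx_ker.
have sU : stablemx U M.
  apply/row_subP => i; rewrite row_mul rowK -mulmxA.
  have -> : horner_mx M 'X^i *m M = horner_mx M ('X^i * 'X).
    by rewrite rmorphM /= horner_mx_X.
  by rewrite (horner_mx_mod _ Mp) inU // submxMl.
have cap : (U :&: W)%MS = 0.
  apply/eqP; apply: contraT => nz; case/rowV0Pn: nz => v.
  rewrite sub_capmx => /andP[/submxP[a ->] /sub_kermxP/LP H] /negP[].
  rewrite mul_krylov_mx; move: H; rewrite mul_krylov_mx; set q := \sum_(i < _) _ => H.
  have sq : (size q <= d.+1)%N.
    apply: (leq_trans (size_sum _ _ _)); apply/bigmax_leqP => j _.
    by rewrite (leq_trans (size_scale_leq _ _)) ?size_polyXn.
  suff -> : q = 0 by rewrite rmorph0 mulmx0.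
  apply/eqP; apply: contraT => q0.
  have s0 : (0 < size q)%N by rewrite size_poly_gt0.
  (* Shifting q to degree d exposes its leading coefficient to [c]. *)
  have := H 'X^(d.+1 - size q); rewrite -(mulmxA u).
  have -> : horner_mx M q *m horner_mx M 'X^(d.+1 - size q) = horner_mx M (q * 'X^(d.+1 - size q)).
    by rewrite rmorphM.
  rewrite hc ?size_mulXn // ?subnK // => /matrixP/(_ 0 0).
  rewrite !mxE coefMXn (_ : (d < _)%N = false); last by lia.
  rewrite (_ : (d - _)%N = (size q).-1); last by lia.
  by rewrite -lead_coefE eqxx mulr1n => /eqP; rewrite lead_coef_eq0 (negPf q0).
exists W => //; split=> //.
(* [L] has d + 1 columns, so [W] has rank at least n - d; disjointness from [U] bounds it above. *)
have := mxrank_disjoint_sum cap; have := rank_leq_col (U + W)%MS.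
rewrite mxrank_ker; have := rank_leq_col L; have := rank_leq_row L.
by move: fU; rewrite /row_free => /eqP ->; lia.
Qed.

(** * Idempotent decomposition of Hessenberg matrices *)

Lemma bidiagonal_idempotent (R : comPzRingType) n (b t : nat -> bool) :
  (forall i, (i.+1 < n)%N -> t i -> b i != b i.+1) -> (forall i, t i -> ~~ t i.+1) ->
  let A : 'M[R]_n := \matrix_(i, j) ((i == j)%:R * (b i)%:R + (t i && (i.+1 == j :> nat))%:R) in
  A *m A = A.
Proof.
(* Links, the ones above the diagonal, are never consecutive, so S^2 = 0; the diagonal bits differ
   across each link, so D S + S D = S. *)
move=> bt tt A; pose D : 'M[R]_n := diag_mx (\row_i (b i)%:R).
pose S : 'M[R]_n := \matrix_(i, j) (t i && (i.+1 == j :> nat))%:R.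
have -> : A = D + S.
  apply/matrixP => i j; rewrite !mxE mulrb.
  by case: eqP => [->|_]; rewrite ?mul1r ?mul0r.
have DD : D *m D = D.
  apply/matrixP => i j; rewrite mul_diag_mx !mxE.
  by case: (b i); rewrite ?mul1r ?mul0r ?mul0rn.
have SS : S *m S = 0.
  apply/matrixP => i j; rewrite !mxE big1 // => k _; rewrite !mxE.
  case ti: (t i) => /=; last by rewrite mul0r.
  case: eqP => [ik|_]; last by rewrite mul0r.
  by rewrite -ik (negPf (tt _ ti)) mulr0.
have DS : D *m S + S *m D = S.
  apply/matrixP => i j; rewrite mx_addE mul_diag_mx mul_mx_diag !mxE.
  case ti: (t i) => /=; last by rewrite mul0r mulr0 addr0.
  case: eqP => [ij|_]; last by rewrite mul0r mulr0 addr0.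
  have := bt i; rewrite ij ltn_ord ti => /(_ isT isT).
  by case: (b i); case: (b j) => // _; rewrite !(mul1r, mul0r, mulr0, mulr1, addr0, add0r).
by rewrite mulmxDl !mulmxDr DD SS addr0 -addrA DS.
Qed.

(** Diagonals of two idempotents, the left one linking (0,1), (2,3), ... and the right one (1,2),
    (3,4), .... Index n is unlinked on the left for n even and on the right for n odd, which frees
    [b]; index 0 is unlinked on the right, which frees [b']. *)
Definition left_bit (n : nat) (b : bool) (i : nat) : bool :=
  if (i == n) && ~~ odd n then b else odd i.

Definition right_bit (n : nat) (b b' : bool) (i : nat) : bool :=
  if i == 0 then b' else if (i == n) && odd n then b else ~~ odd i.

Lemma sum_bits n b b' :
  (\sum_(i < n.+1) (left_bit n b i + right_bit n b b' i) = n + b + b')%N.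
Proof.
have gen m : (m <= n)%N -> (\sum_(i < m) (left_bit n b i + right_bit n b b' i) = if m is m'.+1 then m' + b' else 0)%N.
  elim: m => [|m IH] mn; first by rewrite big_ord0.
  rewrite big_ord_recr IH ?(ltnW mn) //= /left_bit /right_bit (ltn_eqF mn) /=.
  by case: m mn {IH} => [|m] _ /=; [|case: (odd m)]; lia.
rewrite big_ord_recr gen // /left_bit /right_bit /= eqxx /=.
by case: n {gen} => [|n] /=; [|case: (odd n)] => /=; lia.
Qed.

(* Matrix of an endomorphism in a basis u_0, u_1 = u_0 (M - c_0), ...: diagonal
   c, ones above the diagonal, arbitrary last row. The last row goes to one
   idempotent; the ones above the diagonal go alternately to the other two,
   each of which has diagonal {0,1} on every pair of indices it links. The two
   remaining free diagonal bits adjust the trace. *)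
Lemma three_idempotents_hessenberg (R : comPzRingType) n (H : 'M[R]_n.+1) b b' :
  (forall i j : 'I_n.+1, (i < n)%N ->
     H i j = (i == j)%:R * (left_bit n b i + right_bit n b b' i)%:R + (i.+1 == j :> nat)%:R) ->
  \tr H = (n.+1 + b + b')%:R -> sum_of_three_idempotents H.
Proof.
move=> hH tH.
pose tl i := ~~ odd i && (i < n)%N; pose tr i := odd i && (i < n)%N.
pose f : 'M[R]_n.+1 := \matrix_(i, j) ((i == j)%:R * (left_bit n b i)%:R + (tl i && (i.+1 == j :> nat))%:R).
pose g : 'M[R]_n.+1 := \matrix_(i, j) ((i == j)%:R * (right_bit n b b' i)%:R + (tr i && (i.+1 == j :> nat))%:R).
have ff : f *m f = f.
  apply: bidiagonal_idempotent => i.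
    rewrite ltnS /tl /left_bit => ni; rewrite (ltn_eqF ni) => /andP[oi _] /=.
    by case: (i.+1 =P n) => [<-|_] /=; move: oi; case: (odd i).
  by rewrite /tl => /andP[/negPf oi _]; rewrite /= oi.
have gg : g *m g = g.
  apply: bidiagonal_idempotent => i.
    rewrite ltnS /tr /right_bit => ni; rewrite (ltn_eqF ni) => /andP[oi _] /=.
    have -> : (i == 0) = false by case: i oi {ni}.
    by case: (i.+1 =P n) => [<-|_] /=; move: oi; case: (odd i).
  by rewrite /tr => /andP[oi _]; rewrite /= oi.
(* The trace forces the last diagonal entry to exceed its two bits by 1, which is the corner of the
   first idempotent. *)
have Hlast : H ord_max ord_max = (left_bit n b n + right_bit n b b' n).+1%:R.
  apply: (addrI (\sum_(i < n) H (widen_ord (leqnSn n) i) (widen_ord (leqnSn n) i))).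
  have -> : \sum_(i < n) H (widen_ord (leqnSn n) i) (widen_ord (leqnSn n) i) =
      (\sum_(i < n) (left_bit n b i + right_bit n b b' i))%:R.
    rewrite natr_sum; apply: eq_bigr => i _.
    by rewrite hH //= eqxx mul1r gtn_eqF // addr0.
  have := sum_bits n b b'; rewrite big_ord_recr /= -natrD addnS => ->.
  rewrite -!addSn -tH /mxtrace big_ord_recr /=.
  by congr (_ + _); rewrite natr_sum; apply: eq_bigr => i _; rewrite hH //= eqxx mul1r gtn_eqF // addr0.
exists (\matrix_(i, j) if i == ord_max then (if j == ord_max then 1 else H i j) else 0), f, g.
split; try exact/mx_idempotentE.
- apply/mx_idempotentE/matrixP => i j; rewrite !mxE (bigD1 ord_max) //= big1 => [|k kn].
    by rewrite !mxE eqxx; case: ifP => [/eqP ->|]; rewrite ?mul1r ?mul0r addr0.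
  by rewrite !mxE (negPf kn) mulr0.
- apply/matrixP => i j; rewrite !mxE.
  have [->|ni] := eqVneq i ord_max.
    rewrite /tl /tr ltnn !andbF /= !addr0.
    have [->|_] := eqVneq j ord_max.
      by rewrite Hlast !mul1r -natr1 natrD /=; ring.
    by rewrite !mul0r !addr0.
  have ni' : (i < n)%N by rewrite ltn_neqAle -ltnS ltn_ord andbT.
  rewrite hH // /tl /tr ni' !andbT natrD add0r.
  by case: (odd i) => /=; ring.
Qed.

Lemma three_idempotents_cyclic (F : fieldType) n (M : 'M[F]_n.+1) (u : 'rV_n.+1) :
  identity_cube F ->
  (forall q : {poly F}, (size q <= n.+1)%N -> u *m horner_mx M q = 0 -> q = 0) ->
  sum_of_three_idempotents M.
Proof.
move=> cF hu.
(* The difference x is 0, 1 or -1; since 6 = 0, -1 is 1 in characteristic 2 and 2 in characteristic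
   3, so two bits suffice. *)
have [b [b' tM]] : exists b b' : bool, \tr M = (n.+1 + b + b')%:R.
  set x := \tr M - n.+1%:R.
  have : x * (x - 1) * (x + 1) = 0.
    by have -> : x * (x - 1) * (x + 1) = x ^+ 3 - x by [ring]; rewrite cF subrr.
  have tE : \tr M = n.+1%:R + x by rewrite /x; ring.
  move/eqP; rewrite !mulf_eq0 -orbA => /or3P[/eqP x0|/eqP x1|/eqP x2].
  - by exists false, false; rewrite tE x0 !addn0 addr0.
  - by exists true, false; rewrite tE addn0 natrD -[x](subrK 1) x1 add0r.
  have : (2 : F) * 3 = 0.
    have := cF 2 => E; have -> : (2 : F) * 3 = 2 ^+ 3 - 2 by ring.
    by rewrite E subrr.
  move/eqP; rewrite mulf_eq0 => /orP[/eqP n2|/eqP n3].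
    exists true, false; rewrite tE addn0 natrD; congr (_ + _).
    by rewrite (_ : x = x + 1 - 2 + 1); [rewrite x2 n2 subrr add0r|ring].
  exists true, true; rewrite tE -addnA natrD; congr (_ + _).
  by rewrite (_ : x = x + 1 - 3 + 2); [rewrite x2 n3 subrr add0r|ring].
pose c i : F := (left_bit n b i + right_bit n b b' i)%:R.
(* As w_{i+1} = w_i (X - c_i), [M] sends the basis vector u w_i(M) to c_i times itself plus the next
   one. *)
pose w i : {poly F} := \prod_(j < i) ('X - (c j)%:P).
have sw i : size (w i) = i.+1.
  by rewrite size_prod_XsubC -[index_enum _]enumT size_enum_ord.
have wS i : w i.+1 = w i * ('X - (c i)%:P) by rewrite /w big_ord_recr.
pose B : 'M_n.+1 := krylov_mx M u w n.+1.
have uB : B \in unitmx by rewrite -row_free_unit; apply: krylov_mx_free.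
pose H := B *m M *m invmx B.
have BM : B *m M = H *m B by rewrite /H mulmxKV.
have -> : M = invmx B *m H *m B by rewrite -mulmxA -BM mulKmx.
apply: three_idempotents_retract; first exact: mulmxV.
apply: (@three_idempotents_hessenberg _ _ _ b b'); last first.
  by rewrite -tM /H mxtrace_mulC mulKmx.
move=> i j ni.
have ni' : (i.+1 < n.+1)%N by [].
have : row i H = c i *: delta_mx 0 i + delta_mx 0 (Ordinal ni').
  apply: (can_inj (mulmxK uB)); rewrite -row_mul -BM mulmxDl -scalemxAl -!rowE.
  rewrite row_mul !rowK -mulmxA /= wS.
  rewrite rmorphM rmorphB /= horner_mx_X horner_mx_C -mulmxE mulmxBr mulmxBr.
  by rewrite mul_mx_scalar -scalemxAr addrC subrK.
move/rowP/(_ j); rewrite !mxE => ->; rewrite eqxx /= [j == i]eq_sym mulrC; congr (_ + _%:R).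
by rewrite -val_eqE /= eq_sym.
Qed.

(** Induction on the size: a counterexample [M] has no proper stable splitting, so by Fitting every
    matrix commuting with it is nilpotent or invertible. A vector of maximal local minimal
    polynomial then generates a subspace with zero complement, and the cyclic case applies. *)
Lemma three_idempotents_field (F : fieldType) n (M : 'M[F]_n) :
  identity_cube F -> sum_of_three_idempotents M.
Proof.
move=> cF; elim/ltn_ind: n M => -[|n] IH M.
  by exists 0, 0, 0; split; try (by apply/mx_idempotentE; rewrite mul0mx); apply/matrixP => -[].
apply: contrapT => nT.
have split_case m1 m2 (U : 'M[F]_(m1, n.+1)) (W : 'M[F]_(m2, n.+1)) :
    stablemx U M -> stablemx W M -> (U :&: W)%MS = 0 ->
    (\rank U + \rank W = n.+1)%N -> (0 < \rank U)%N -> (0 < \rank W)%N -> False.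
  move=> sU sW UW r rU rW; apply: nT.
  by apply: (three_idempotents_direct sU sW UW r) => A; apply: IH; lia.
have hM N : comm_mx M N -> (exists k, N ^+ k = 0) \/ N \in unitmx.
  move=> cMN; have [|uN] := boolP (N \in unitmx); first by right.
  left; apply: contrapT => nn.
  have [|K [cMK /andP[rK rK'] cap]] := @fitting_split _ _ M N cMN _ uN.
    by move=> k; apply/eqP => Nk; apply: nn; exists k.
  apply: (split_case _ _ K (kermx K)) => //.
  - by rewrite -cMK submxMl.
  - by apply/sub_kermxP; rewrite -mulmxA cMK mulmxA mulmx_ker mul0mx.
  - by rewrite mxrank_ker subnKC // ltnW.
  - by rewrite mxrank_ker subn_gt0.
have [u [p [hp Mp]]] := cyclic_minpoly_ex hM.
have [d sp] : exists d, size p = d.+2.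
  case: hp => p0 hp; have := p0; rewrite -size_poly_gt0.
  case E: (size p) => [|[|d]] // _; last by exists d.
  have /size_poly1P[a a0 pa] : size p == 1 by rewrite E.
  move: Mp; rewrite pa horner_mx_C => /matrixP/(_ 0 0); rewrite !mxE eqxx mulr1n.
  by move=> a1; rewrite a1 eqxx in a0.
have [W sW [fU cap sU r]] := cyclic_complement hp Mp sp.
apply: nT; apply: (@three_idempotents_cyclic _ _ _ u) => // q sq /eqP.
rewrite (proj2 hp) => pq; apply/eqP; apply: contraT => q0.
(* A nonzero q of size at most n + 1 annihilating [u] would leave a complement [W] of positive
   rank. *)
have dn : (d < n)%N by have := dvdp_leq q0 pq; rewrite sp => /leq_trans /(_ sq).
move: r fU (split_case _ _ _ _ sU sW cap r); rewrite /row_free => r /eqP rU.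
by rewrite rU in r *; case; lia.
Qed.

(** * Rings satisfying x^3 = x *)

Lemma cube_6_eq0 (R : comPzRingType) : identity_cube R -> 6 = 0 :> R.
Proof.
by move=> cR; have -> : 6 = 2 ^+ 3 - 2 :> R by [ring]; rewrite cR subrr.
Qed.

Lemma identity_cube_F2 : identity_cube 'F_2.
Proof. by case=> -[|[|m]] // lm; apply: val_inj. Qed.

Lemma identity_cube_F3 : identity_cube 'F_3.
Proof. by case=> -[|[|[|m]]] // lm; apply: val_inj. Qed.

(** For idempotent [c], a decomposition over the corner ring cR, written with matrices over R that
    [c] fixes. *)
Definition sum_of_three_idempotents_on (R : comPzRingType) n (c : R) (M : 'M[R]_n) :=
  exists e f g : 'M[R]_n,
    [/\ e *m e = e /\ c *: e = e, f *m f = f /\ c *: f = f,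
        g *m g = g /\ c *: g = g & c *: M = e + f + g].

Lemma three_idempotents_on_add (R : comPzRingType) n (c d : R) (M : 'M[R]_n) :
  c * d = 0 -> sum_of_three_idempotents_on c M -> sum_of_three_idempotents_on d M ->
  sum_of_three_idempotents_on (c + d) M.
Proof.
move=> cd [e [f [g [he hf hg E]]]] [e' [f' [g' [he' hf' hg' E']]]].
have idem (h h' : 'M[R]_n) : h *m h = h /\ c *: h = h -> h' *m h' = h' /\ d *: h' = h' ->
    (h + h') *m (h + h') = h + h' /\ (c + d) *: (h + h') = h + h'.
  move=> [hh ch] [hh' dh'].
  have dh : d *: h = 0 by rewrite -ch scalerA mulrC cd scale0r.
  have ch' : c *: h' = 0 by rewrite -dh' scalerA cd scale0r.
  have hh'0 : h *m h' = 0 by rewrite -dh' -scalemxAr scalemxAl dh mul0mx.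
  have h'h0 : h' *m h = 0 by rewrite -ch -scalemxAr scalemxAl ch' mul0mx.
  split; first by rewrite mulmxDl !mulmxDr hh hh' hh'0 h'h0 addr0 add0r.
  by rewrite scalerDl !scalerDr ch dh ch' dh' addr0 add0r.
exists (e + e'), (f + f'), (g + g'); split; try exact: idem.
by rewrite scalerDl E E'; mxlin.
Qed.

(** The entries of [c *: M] come from F_p, and [c] times the lift preserves sums and products, so
    the field case carries over. *)
Lemma three_idempotents_on_Fp (R : comPzRingType) n (c : R) p (M : 'M[R]_n) :
  prime p -> identity_cube 'F_p -> c * c = c -> c * p%:R = 0 ->
  (forall i j, exists k : nat, c * M i j = c * k%:R) ->
  sum_of_three_idempotents_on c M.
Proof.
move=> pp cF cc cp hM.
have h i j : {k : nat | c * M i j = c * k%:R} by apply: cid.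
pose M' : 'M['F_p]_n := \matrix_(i, j) (sval (h i j))%:R.
have hM' i j : c * M i j = c * lift_Fp R (M' i j).
  by rewrite mxE lift_Fp_nat //; case: (h i j).
have [e [f [g [/mx_idempotentE ee /mx_idempotentE ff /mx_idempotentE gg E]]]] :=
  @three_idempotents_field 'F_p n M' cF.
pose L (A : 'M['F_p]_n) : 'M[R]_n := c *: map_mx (@lift_Fp R p) A.
have idem A : A *m A = A -> L A *m L A = L A /\ c *: L A = L A.
  move=> AA; split; last by rewrite /L scalerA cc.
  rewrite /L -scalemxAl -scalemxAr scalerA cc; apply/matrixP => i j.
  rewrite -[in RHS]AA !mxE lift_Fp_sum // !mulr_sumr; apply: eq_bigr => k _.
  by rewrite !mxE lift_FpM.
exists (L e), (L f), (L g); split; try exact: idem.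
apply/matrixP => i j; rewrite !(mx_addE, mx_scaleE) hM' E !mxE.
apply: (etrans (lift_FpD (e i j + f i j) (g i j) pp cp)).
by rewrite mulrDr (lift_FpD (e i j) (f i j) pp cp) !mulrDr.
Qed.

(* For x with x^3 = x the ring splits along the orthogonal idempotents
   1 - x^2, 2x - x^2 and 2x^2 - 2x, on which x acts as 0, 1 and 2. *)
Lemma three_idempotents_on_split (R : comPzRingType) n (M : 'M[R]_n) (s : seq R) (c : R) :
  identity_cube R -> c * c = c ->
  (forall c', c' * c' = c' -> c' * c = c' ->
     {in s, forall x, exists k : nat, c' * x = c' * k%:R} ->
     sum_of_three_idempotents_on c' M) ->
  sum_of_three_idempotents_on c M.
Proof.
move=> cR; elim: s c => [|x s IH] c cc H; first by apply: H => //; rewrite mulrC.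
have x3 := cR x; have R6 := cube_6_eq0 cR.
have part J k : J * J = J -> J * x = J * k%:R -> sum_of_three_idempotents_on (c * J) M.
  move=> JJ Jx; apply: IH; first by rewrite mulrACA cc JJ.
  move=> c' cc' c'J hs; have c'c : c' * c = c'.
    by rewrite -{1}c'J -mulrA mulrAC cc c'J.
  apply: H => // y; rewrite inE => /predU1P[->|/hs //]; exists k.
  by rewrite -c'J -!mulrA Jx.
pose j0 := 1 - x ^+ 2; pose j1 := 2 * x - x ^+ 2; pose j2 := 2 * x ^+ 2 - 2 * x.
have J0 : j0 * j0 = j0.
  have -> : j0 * j0 = j0 + x * (x ^+ 3 - x) by rewrite /j0; ring.
  by rewrite x3 subrr mulr0 addr0.
have J1 : j1 * j1 = j1.
  have -> : j1 * j1 = j1 + (x - 4) * (x ^+ 3 - x) + 6 * (x ^+ 2 - x) by rewrite /j1; ring.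
  by rewrite x3 R6 subrr mulr0 mul0r !addr0.
have J2 : j2 * j2 = j2.
  have -> : j2 * j2 = j2 + (4 * x - 8) * (x ^+ 3 - x) + 6 * (x ^+ 2 - x) by rewrite /j2; ring.
  by rewrite x3 R6 subrr mulr0 mul0r !addr0.
have X0 : j0 * x = j0 * 0%:R.
  have -> : j0 * x = j0 * 0%:R - (x ^+ 3 - x) by rewrite /j0; ring.
  by rewrite x3 subrr subr0.
(* Obtained from the cube identity at x + 1. *)
have R3 : 3 * (x ^+ 2 - x) = 0.
  have -> : 3 * (x ^+ 2 - x) = (x + 1) ^+ 3 - (x + 1) - (x ^+ 3 - x) - 6 * x by ring.
  by rewrite !cR R6 !subrr mul0r subrr.
have X1 : j1 * x = j1 * 1%:R.
  have -> : j1 * x = j1 * 1%:R - (x ^+ 3 - x) + 3 * (x ^+ 2 - x) by rewrite /j1; ring.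
  by rewrite x3 R3 subrr subr0 addr0.
have X2 : j2 * x = j2 * 2%:R.
  have -> : j2 * x = j2 * 2 + 2 * (x ^+ 3 - x) - 6 * (x ^+ 2 - x) by rewrite /j2; ring.
  by rewrite x3 R6 subrr mulr0 mul0r addr0 subr0.
have -> : c = c * j0 + c * j1 + c * j2 by rewrite /j0 /j1 /j2; ring.
apply: three_idempotents_on_add (part _ _ J2 X2).
  have -> : (c * j0 + c * j1) * (c * j2) =
      c * c * ((2 - 4 * x) * (x ^+ 3 - x) + 6 * (x ^+ 3 - x ^+ 2)).
    by rewrite /j0 /j1 /j2; ring.
  by rewrite x3 R6 subrr mulr0 mul0r addr0 mulr0.
apply: three_idempotents_on_add (part _ _ J0 X0) (part _ _ J1 X1).
have -> : (c * j0) * (c * j1) = c * c * ((x - 2) * (x ^+ 3 - x)).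
  by rewrite /j0 /j1; ring.
by rewrite x3 subrr !mulr0.
Qed.

Lemma three_idempotents_cube_ring (R : comPzRingType) n (M : 'M[R]_n) :
  identity_cube R -> sum_of_three_idempotents M.
Proof.
move=> cR; have R6 := cube_6_eq0 cR.
have main c p : prime p -> identity_cube 'F_p -> c * c = c -> c * p%:R = 0 ->
    sum_of_three_idempotents_on c M.
  move=> pp cF cc cp.
  pose s := [seq M t.1 t.2 | t : 'I_n * 'I_n].
  apply: (@three_idempotents_on_split _ _ _ s) => // c' cc' c'c hs.
  apply: (three_idempotents_on_Fp pp cF cc').
    by rewrite -c'c -mulrA cp mulr0.
  by move=> i j; apply: hs; apply/mapP; exists (i, j); rewrite ?mem_enum.
have h3 : sum_of_three_idempotents_on (3 : R) M.
  apply: (main 3 2) => //; first exact: identity_cube_F2.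
    by have -> : 3 * 3 = 6 + 3 :> R by [ring]; rewrite R6 add0r.
  by rewrite -R6; ring.
have h4 : sum_of_three_idempotents_on (4 : R) M.
  apply: (main 4 3) => //; first exact: identity_cube_F3.
    by have -> : 4 * 4 = 6 * 2 + 4 :> R by [ring]; rewrite R6 mul0r add0r.
  by have -> : 4 * 3%:R = 6 * 2 :> R by [ring]; rewrite R6 mul0r.
have [|e [f [g [[ee _] [ff _] [gg _] E]]]] := three_idempotents_on_add _ h3 h4.
  by have -> : 3 * 4 = 6 * 2 :> R by [ring]; rewrite R6 mul0r.
exists e, f, g; split; try exact/mx_idempotentE.
rewrite -E -[LHS]scale1r; congr (_ *: _).
by rewrite -[LHS]add0r -R6; ring.
Qed.

(** * Peirce decomposition along complementary idempotents *)

Definition corner_pred (R : comPzRingType) (c : R) : {pred R} := fun x => c * x == x.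

(** The ideal cR as a ring with unit [c]; the type carries [cc] because the ring operations depend
    on it. *)
Definition corner (R : comPzRingType) (c : R) (cc : c * c = c) : Type :=
  {x : R | x \in corner_pred c}.

Lemma corner_pred_zmod_closed (R : comPzRingType) (c : R) : zmod_closed (corner_pred c).
Proof.
split=> [|x y]; first by rewrite unfold_in mulr0.
by rewrite !unfold_in mulrBr => /eqP -> /eqP ->.
Qed.

HB.instance Definition _ (R : comPzRingType) (c : R) :=
  GRing.isZmodClosed.Build R (corner_pred c) (corner_pred_zmod_closed c).
HB.instance Definition _ (R : comPzRingType) (c : R) (cc : c * c = c) :=
  SubChoice.on (corner cc).
HB.instance Definition _ (R : comPzRingType) (c : R) (cc : c * c = c) :=
  [SubChoice_isSubZmodule of corner cc by <:].

Lemma corner_in (R : comPzRingType) (c : R) (cc : c * c = c) x : c * x \in corner_pred c.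
Proof. by rewrite unfold_in mulrA cc. Qed.

Definition corner_proj (R : comPzRingType) (c : R) (cc : c * c = c) (x : R) : corner cc :=
  exist _ (c * x) (corner_in cc x).

(** The extra factor [c] makes membership immediate; [corner_valM] removes it. *)
Definition corner_mul (R : comPzRingType) (c : R) (cc : c * c = c) (x y : corner cc) :=
  corner_proj cc (val x * val y).

Lemma cornerE (R : comPzRingType) (c : R) (cc : c * c = c) (x : corner cc) :
  c * val x = val x.
Proof. exact/eqP/(valP x). Qed.

Lemma corner_mulA (R : comPzRingType) (c : R) (cc : c * c = c) :
  associative (@corner_mul R c cc).
Proof. by move=> x y z; apply: val_inj => /=; ring. Qed.

Lemma corner_mulC (R : comPzRingType) (c : R) (cc : c * c = c) :
  commutative (@corner_mul R c cc).
Proof. by move=> x y; apply: val_inj => /=; rewrite [val x * _]mulrC. Qed.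

Lemma corner_mul1 (R : comPzRingType) (c : R) (cc : c * c = c) :
  left_id (corner_proj cc 1) (@corner_mul R c cc).
Proof. by move=> x; apply: val_inj => /=; rewrite mulr1 !cornerE. Qed.

Lemma corner_mulDl (R : comPzRingType) (c : R) (cc : c * c = c) :
  left_distributive (@corner_mul R c cc) +%R.
Proof. by move=> x y z; apply: val_inj => /=; rewrite mulrDl mulrDr. Qed.

HB.instance Definition _ (R : comPzRingType) (c : R) (cc : c * c = c) :=
  GRing.Zmodule_isComPzRing.Build (corner cc) (corner_mulA (cc := cc))
    (corner_mulC (cc := cc)) (corner_mul1 (cc := cc)) (corner_mulDl (cc := cc)).

Lemma corner_valM (R : comPzRingType) (c : R) (cc : c * c = c) (x y : corner cc) :
  val (x * y) = val x * val y.
Proof. by rewrite -[LHS]/(c * (val x * val y)) mulrA cornerE. Qed.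

Lemma corner_decomposition (R : comPzRingType) (c d : R) (cc : c * c = c)
    (dd : d * d = d) :
  c + d = 1 -> c * d = 0 -> ring_isomorphic R (corner cc * corner dd)%type.
Proof.
move=> cd1 cd0.
pose f x : corner cc * corner dd := (corner_proj cc x, corner_proj dd x).
have fB : GRing.zmod_morphism f.
  by move=> x y; congr pair; apply: val_inj => /=; rewrite mulrBr.
have fM : GRing.monoid_morphism f.
  split=> [//|x y]; congr pair; apply: val_inj; rewrite [RHS]corner_valM /=.
    by rewrite mulrACA cc.
  by rewrite mulrACA dd.
pose phi : {rmorphism R -> (corner cc * corner dd)%type} :=
  HB.pack f (GRing.isZmodMorphism.Build _ _ f fB) (GRing.isMonoidMorphism.Build _ _ f fM).
exists phi; exists (fun y => val y.1 + val y.2) => [x|[x y]] /=.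
  by rewrite -mulrDl cd1 mul1r.
congr pair; apply: val_inj => /=; rewrite mulrDr.
  by rewrite cornerE -(cornerE y) mulrA cd0 mul0r addr0.
by rewrite cornerE -(cornerE x) mulrA [d * c]mulrC cd0 mul0r add0r.
Qed.

(** * Morphisms to Z_3 *)

Lemma natr_mod3 (S : comPzRingType) k : 3 = 0 :> S -> (k %% 3)%:R = k%:R :> S.
Proof.
by move=> S3; rewrite [in RHS](divn_eq k 3) natrD natrM S3 mulr0 add0r.
Qed.

(* A maximal ideal I avoiding x: if y, y - 1, y - 2 were all outside I, then x
   would be congruent mod I to multiples of each of them, and x = x^3 to a
   multiple of y (y - 1) (y - 2) = 0. *)
Lemma morphism_Z3_separating (S : comPzRingType) (x : S) :
  identity_cube S -> 3 = 0 :> S -> x != 0 ->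
  exists phi : {rmorphism S -> 'Z_3}, phi x != 0.
Proof.
move=> cS S3 x0.
(* Membership of 0 is left out so that the union of the empty chain satisfies [P]; maximality
   restores it in [I0]. *)
pose P (I : set S) := [/\ forall a b, I a -> I b -> I (a + b),
  forall r a, I a -> I (r * a) & ~ I x].
have [I [[ID IM Ix] Imax]] : exists I, P I /\ forall J, (I `<=` J)%classic -> P J -> J = I.
  have [|I [PI Imax]] := @Zorn_bigcup S P.
    move=> C CP Ctot; split=> [a b [I CI Ia] [J CJ Jb]|r a [I CI Ia]|[I CI Ix]].
    - have [IJ|JI] := Ctot _ _ CI CJ.
        by have [JD _ _] := CP _ CJ; exists J => //; apply: JD => //; apply: IJ.
      by have [ID _ _] := CP _ CI; exists I => //; apply: ID => //; apply: JI.
    - by have [_ IM _] := CP _ CI; exists I => //; apply: IM.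
    - by have [_ _] := CP _ CI; apply.
  exists I; split=> // J IJ PJ; rewrite eqEsubset; split=> //.
  by apply: contrapT => JI; apply: (Imax J).
have I0 : I 0.
  suff <- : [set z | I z \/ z = 0]%classic = I by right.
  apply: Imax; first by move=> z; left.
  split=> [a b [Ia|->] [Ib|->]|r a [Ia|->]|[//|/eqP]]; rewrite ?add0r ?addr0 ?mulr0 /=.
  - by left; apply: ID.
  - by left.
  - by left.
  - by right.
  - by left; apply: IM.
  - by right.
  - by rewrite (negPf x0).
have IN a : I a -> I (- a) by move=> Ia; rewrite -mulN1r; apply: IM.
(* The ideal I + S y is strictly larger, so it contains [x] by maximality. *)
have out y : ~ I y -> exists r, I (x - r * y).
  move=> Iy; apply: contrapT => H.
  have PJ : P [set z | exists r, I (z - r * y)]%classic.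
    split=> [a b [r Ir] [s Is]|s a [r Ir]|[r Ir]].
    - by exists (r + s); rewrite mulrDl opprD addrACA; apply: ID.
    - by exists (s * r); rewrite -mulrA -mulrBr; apply: IM.
    - by apply: H; exists r.
  apply: Iy; rewrite -(Imax _ _ PJ); first by exists 1; rewrite mul1r subrr.
  by move=> z Iz; exists 0; rewrite mul0r subr0.
have ex y : exists k : 'Z_3, I (y - (k : nat)%:R).
  apply: contrapT => nk.
  have [a Ia] : exists a, I (x - a * y).
    by apply: out => Iy; apply: nk; exists 0; rewrite subr0.
  have [b Ib] : exists b, I (x - b * (y - 1)).
    by apply: out => Iy; apply: nk; exists 1.
  have [c Ic] : exists c, I (x - c * (y - 2)).
    by apply: out => Iy; apply: nk; exists (inord 2); rewrite inordK.
  apply: Ix; rewrite -(cS x).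
  have -> : x ^+ 3 = x ^+ 2 * (x - a * y) + (x * a * y) * (x - b * (y - 1))
     + (a * y * b * (y - 1)) * (x - c * (y - 2)) + a * b * c * (y ^+ 3 - y + 3 * (y - y ^+ 2)) by ring.
  rewrite cS S3 subrr mul0r addr0 mulr0 addr0.
  exact: ID _ _ (ID _ _ (IM _ _ Ia) (IM _ _ Ib)) (IM _ _ Ic).
have I1 : ~ I 1 by move=> I1; apply: Ix; rewrite -[x]mulr1; apply: IM.
have uniq (k l : 'Z_3) : I ((k : nat)%:R - (l : nat)%:R) -> k = l.
  have I2 : ~ I 2.
    move=> I2; apply: I1; have -> : 1 = 2 * 2 - 3 :> S by ring.
    by rewrite S3 subr0; apply: IM.
  move=> Ikl; have := IN _ Ikl; rewrite opprB; move: Ikl.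
  case: k l => -[|[|[|k]]] // lk [[|[|[|l]]] // ll] /=; rewrite ?subr0 ?sub0r => Ikl Ilk.
  all: try exact: val_inj.
  all: try by case: I1.
  all: try by case: I2.
  - by case: I1; have -> : 1 = 2%:R - 1%:R :> S by ring.
  - by case: I1; have -> : 1 = 2%:R - 1%:R :> S by ring.
pose f y := sval (cid (ex y)).
have fI y : I (y - (f y : nat)%:R) by rewrite /f; case: cid.
have LD (k l : 'Z_3) : ((k + l)%R : nat)%:R = (k : nat)%:R + (l : nat)%:R :> S.
  by rewrite -natrD; exact: (natr_mod3 (k + l)%N S3).
have LM (k l : 'Z_3) : ((k * l)%R : nat)%:R = (k : nat)%:R * (l : nat)%:R :> S.
  by rewrite -natrM; exact: (natr_mod3 (k * l)%N S3).
(* [f y] is the only residue congruent to [y], so the morphism laws reduce to congruences modulo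
   [I]. *)
have fE y k : I (y - ((k : 'Z_3) : nat)%:R) -> f y = k.
  move=> Ik; apply: uniq; have := ID _ _ Ik (IN _ (fI y)).
  by congr I; ring.
have fB : GRing.zmod_morphism f.
  move=> y z; apply: fE; have := ID _ _ (fI y) (IN _ (fI z)); congr I.
  by have := LD (f y - f z) (f z); rewrite subrK => ->; ring.
have fM : GRing.monoid_morphism f.
  split; first by apply: fE; rewrite subrr.
  move=> y z; apply: fE; rewrite LM.
  have := ID _ _ (IM z _ (fI y)) (IM (f y : nat)%:R _ (fI z)); congr I; ring.
pose phi : {rmorphism S -> 'Z_3} :=
  HB.pack f (GRing.isZmodMorphism.Build _ _ f fB) (GRing.isMonoidMorphism.Build _ _ f fM).
exists phi; apply/eqP => fx; apply: Ix; have := fI x.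
by rewrite -[f x]/(phi x) fx subr0.
Qed.

(** The index set consists of all morphisms to Z_3: they separate points, and each is onto because
    integers already cover Z_3. *)
Lemma cube_subdirect_Z3 (S : comPzRingType) :
  identity_cube S -> 3 = 0 :> S -> subdirect_product_of_Z3 S.
Proof.
move=> cS S3.
pose f (s : S) (i : {rmorphism S -> 'Z_3}) := i s.
have fB : GRing.zmod_morphism f by move=> x y; apply/funext => i; rewrite /f rmorphB.
have fM : GRing.monoid_morphism f.
  by split=> [|x y]; apply/funext => i; rewrite /f ?rmorph1 ?rmorphM.
pose phi : {rmorphism S -> ({rmorphism S -> 'Z_3} -> 'Z_3)} :=
  HB.pack f (GRing.isZmodMorphism.Build _ _ f fB) (GRing.isMonoidMorphism.Build _ _ f fM).
exists {rmorphism S -> 'Z_3}, phi; split.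
  move=> x y xy; apply/eqP; rewrite -subr_eq0; apply: contraT.
  move=> /(morphism_Z3_separating cS S3)[i]; rewrite rmorphB.
  by rewrite -[i x]/(phi x i) xy subrr eqxx.
by move=> i z; exists (z : nat)%:R; rewrite -[phi _ _]/(i _) rmorph_nat natr_Zp.
Qed.

Lemma cube_decomposition (R : comPzRingType) :
  identity_cube R ->
  exists A B : pzRingType,
    [/\ ring_isomorphic R (A * B)%type, boolean_ring A
      & zero_ring B \/ subdirect_product_of_Z3 B].
Proof.
move=> cR; have R6 := cube_6_eq0 cR.
have c3 : 3 * 3 = 3 :> R by have -> : 3 * 3 = 6 + 3 :> R by [ring]; rewrite R6 add0r.
have c4 : 4 * 4 = 4 :> R by have -> : 4 * 4 = 6 * 2 + 4 :> R by [ring]; rewrite R6 mul0r add0r.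
exists (corner c3), (corner c4); split.
- apply: corner_decomposition.
    by have -> : 3 + 4 = 6 + 1 :> R by [ring]; rewrite R6 add0r.
  by have -> : 3 * 4 = 6 * 2 :> R by [ring]; rewrite R6 mul0r.
- move=> x; apply: val_inj; rewrite expr2 corner_valM -(cornerE x).
  set y := val x.
  (* The cube identity at y + 1 and at y gives 3 y^2 + 3 y = 0; with 6 = 0 this yields 9 y^2 = 3
     y. *)
  have -> : 3 * y * (3 * y) = 6 * y ^+ 2 + ((y + 1) ^+ 3 - (y + 1)) - (y ^+ 3 - y) - 6 * y + 3 * y by ring.
  by rewrite !cR !subrr R6 !mul0r !subr0 !add0r.
right; apply: cube_subdirect_Z3.
  move=> x; apply: val_inj; rewrite !exprS expr0 mulr1 !corner_valM.
  by have := cR (val x); rewrite !exprS expr0 mulr1.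
apply: val_inj; transitivity (6 * 2 : R); last by rewrite R6 mul0r.
by transitivity (4 * 1 + (4 * 1 + 4 * 1) : R); last ring.
Qed.

Lemma cube_of_decomposition (R A B : pzRingType) :
  ring_isomorphic R (A * B)%type -> boolean_ring A ->
  zero_ring B \/ subdirect_product_of_Z3 B -> identity_cube R.
Proof.
move=> [phi phi_bij] bA hB x; apply: (bij_inj phi_bij); rewrite rmorphXn.
have cA (a : A) : a ^+ 3 = a by rewrite exprS (bA a) -expr2 (bA a).
have cB (b : B) : b ^+ 3 = b.
  case: hB => [zB|[I [psi [psi_inj _]]]]; first by rewrite (zB b) expr0n.
  apply: psi_inj; rewrite rmorphXn; apply/funext => i.
  rewrite !exprS expr0 mulr1 -[LHS]/(psi b i * (psi b i * psi b i)).
  by case: (psi b i) => -[|[|[|m]]] // lm; apply: val_inj.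
case: (phi x) => a b; rewrite -[RHS]/(a, b) -[in RHS](cA a) -[in RHS](cB b).
by rewrite !exprS expr0.
Qed.

Theorem theorem1p3 (R : comPzRingType) (n : nat)
    (hR : forall x : R, nilpotent_elt x -> x = 0) (hn : (1 <= n)%N) :
  [<-> (forall M : 'M[R]_n, sum_of_three_idempotents M);
       (exists A B : pzRingType,
          [/\ ring_isomorphic R (A * B)%type, boolean_ring A
            & zero_ring B \/ subdirect_product_of_Z3 B]);
       identity_cube R].
Proof.
tfae.
- case: n hn => // n _ hM; exact/cube_decomposition/(three_idempotents_cube hR hM).
- by move=> [A [B [iso bA hB]]]; apply: cube_of_decomposition iso bA hB.
- by move=> cR M; apply: three_idempotents_cube_ring.
Qed.
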